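(* Let $q$ be a complex number with $0<|q|<1$, let $\alpha\ge 0$ be real, let $r\ge 2$ be an integer, let $\zeta_r=e^{2\pi i/r}$, and let $a,t\in\mathbb{C}$, where $|t|<1$ is assumed in the case $\alpha=0$. Then $$A_{q^r}^{(r\alpha)}(a^{r};t^{r})=\sum_{k_1,\dots,k_{r-1}=0}^{\infty}\frac{(a;q)_{k_1}\cdots(a;q)_{k_{r-1}}\,\zeta_r^{\sum_{i=1}^{r-1}ik_i}\,q^{\alpha\left(\sum_{i=1}^{r-1}k_i\right)^{2}}\,t^{\sum_{i=1}^{r-1}k_i}}{(q;q)_{k_1}\cdots(q;q)_{k_{r-1}}}\;A_{q}^{(\alpha)}\!\left(a;\,q^{2\alpha\sum_{i=1}^{r-1}k_i}\,t\right)$$ and $$A_{q^r}^{(r\alpha)}(a^{r};t^{r})=\sum_{k_2,\dots,k_r=0}^{\infty}\frac{(a;q)_{k_2}\cdots(a;q)_{k_r}\,\zeta_r^{\sum_{i=2}^{r-1}ik_i}\,q^{\alpha\left(\sum_{i=2}^{r}k_i\right)^{2}}\,t^{\sum_{i=2}^{r}k_i}}{(q;q)_{k_2}\cdots(q;q)_{k_r}}\;A_{q}^{(\alpha)}\!\left(a;\,\zeta_r\,q^{2\alpha\sum_{i=2}^{r}k_i}\,t\right).$$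
   Context: For $0<|p|<1$ and an integer $n\ge 0$, $(x;p)_n=\prod_{j=0}^{n-1}(1-xp^j)$. For $\alpha\ge 0$ define $$A_{q}^{(\alpha)}(a;t)=\sum_{n=0}^{\infty}\frac{(a;q)_{n}\,q^{\alpha n^{2}}\,t^{n}}{(q;q)_{n}}.$$ Thus $A_{q^r}^{(r\alpha)}(a^r;t^r)=\sum_{n\ge0}\frac{(a^r;q^r)_n\,q^{\alpha r^2n^2}t^{rn}}{(q^r;q^r)_n}$. Real powers are taken with a fixed choice of $\log q$: $q^x=e^{x\log q}$ and $(q^r)^x=q^{rx}$. Empty sums in exponents (such as $\sum_{i=2}^{r-1}ik_i$ when $r=2$) equal $0$. *)

(* Defs.v *)
From HB Require Import structures.
From mathcomp Require Import all_boot all_order all_algebra.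
From mathcomp Require Import finmap complex.
From mathcomp Require Import all_classical all_reals all_analysis.
From mathcomp Require Import summability.

Set Implicit Arguments.
Unset Strict Implicit.
Unset Printing Implicit Defensive.

Import Order.TTheory GRing.Theory Num.Theory.
Import numFieldNormedType.Exports.

Local Open Scope classical_set_scope.
Local Open Scope ring_scope.
Local Open Scope complex_scope.

(* The complex numbers are R[i] for a realType R; their topology is the one
   given by the modulus, which the library attaches to the regular module
   R[i]^o of the numFieldType R[i]. *)

Definition expC (R : realType) (z : R[i]) : R[i] :=
  (expR (complex.Re z))%:C * (cos (complex.Im z) +i* sin (complex.Im z)).

(* q^x = e^(x log q) for real x, where [lq] is the chosen value of log q. *)
Definition qpow (R : realType) (lq : R[i]) (x : R) : R[i] := expC (x%:C * lq).

Definition qpoch (R : realType) (x p : R[i]) (n : nat) : R[i] :=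
  \prod_(j < n) (1 - x * p ^+ j).

Definition zetaC (R : realType) (r : nat) : R[i] :=
  expC (0 +i* (2 * pi / r%:R)).

(* The base [q] comes with a choice [lq] of its logarithm (expC lq = q), which
   only enters through the real power q^(alpha n^2).  The base q^r is used
   with the logarithm r * lq, which gives (q^r)^x = q^(r x). *)
Definition qA_term (R : realType) (q lq : R[i]) (alpha : R) (a t : R[i])
    (n : nat) : R[i] :=
  qpoch a q n * qpow lq (alpha * n%:R ^+ 2) * t ^+ n / qpoch q q n.

Definition qA_cvg (R : realType) (q lq : R[i]) (alpha : R) (a t : R[i]) : Prop :=
  cvgn (series (qA_term q lq alpha a t : nat -> R[i]^o)).

Definition qA (R : realType) (q lq : R[i]) (alpha : R) (a t : R[i]) : R[i] :=
  limn (series (qA_term q lq alpha a t : nat -> R[i]^o)).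

Definition ksum (m : nat) (k : {ffun 'I_m -> nat}) : nat := (\sum_(i < m) k i)%N.

(* Unconditional convergence of a multiple series to [s]: the finite partial
   sums converge along the directed set of finite sets of multi-indices. *)
Definition multisum (R : realType) (m : nat)
    (f : {ffun 'I_m -> nat} -> R[i]) (s : R[i]) : Prop :=
  partial_sum (f : {ffun 'I_m -> nat} -> R[i]^o) @ totally --> (s : R[i]^o).

(* Main.v *)
(* By the q-binomial theorem the power series f(x) with coefficients
   (a;q)_n / (q;q)_n equals (ax;q)_oo / (x;q)_oo, so the product of f(zeta^i x)
   over the r-th roots of unity is (a^r x^r; q^r)_oo / (x^r; q^r)_oo.  Only the
   functional equation (1 - x) f(x) = (1 - a x) f(q x) is needed for this: over
   the r-th roots of unity it multiplies to (1 - x^r) G(x) = (1 - a^r x^r) G(q x),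
   which determines the coefficients of G.  It is used for truncated polynomials,
   modulo X^M.

   Weighting the coefficient of x^N by q^(alpha N^2) t^N turns the coefficients
   of G into the terms of the left-hand side, and the r-fold Cauchy product into
   the multiple series; splitting off one factor gives the inner series.  The
   weighted r-fold series is dominated by B s^(2N) with s < 1, N being the total
   degree, so everything of total degree at least L contributes at most
   B s^L (1 - s)^-r, which gives unconditional convergence and the value. *)
Require Import Defs.
From HB Require Import structures.
From mathcomp Require Import all_boot all_order all_algebra.
From mathcomp Require Import finmap complex.
From mathcomp Require Import all_classical all_reals all_analysis.
From mathcomp Require Import summability.
From mathcomp Require Import ring lra zify.

Set Implicit Arguments.
Unset Strict Implicit.
Unset Printing Implicit Defensive.

Import Order.TTheory GRing.Theory Num.Theory.
Import numFieldNormedType.Exports.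

Local Open Scope classical_set_scope.
Local Open Scope ring_scope.
Local Open Scope complex_scope.

(** * Coefficients of products of truncated q-binomial series *)

Section QBinomialCoefficients.
Variable F : fieldType.
Implicit Types (q a x : F) (M N r : nat).

Definition eqmod_Xn M (p1 p2 : {poly F}) := forall i, (i < M)%N -> p1`_i = p2`_i.

Lemma eqmod_XnM M (p1 p2 p1' p2' : {poly F}) :
  eqmod_Xn M p1 p1' -> eqmod_Xn M p2 p2' -> eqmod_Xn M (p1 * p2) (p1' * p2').
Proof.
move=> h1 h2 i iM; rewrite !coefM; apply: eq_bigr => j _.
by rewrite h1 ?h2 //; have := ltn_ord j; lia.
Qed.

(** This is p'(X) = p(q X), stated on coefficients. *)
Definition coef_scaled q (p p' : {poly F}) := forall i, p'`_i = q ^+ i * p`_i.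

Lemma coef_scaledM q (p1 p2 p1' p2' : {poly F}) :
  coef_scaled q p1 p1' -> coef_scaled q p2 p2' ->
  coef_scaled q (p1 * p2) (p1' * p2').
Proof.
move=> h1 h2 i; rewrite !coefM mulr_sumr; apply: eq_bigr => j _.
by rewrite h1 h2 mulrACA -exprD subnKC // -ltnS.
Qed.

(** Substitution of a X for X in the hypothesis. *)
Lemma prod_1subX_scale r (s : seq F) a :
  \prod_(x <- s) (1 - x *: 'X) = 1 - 'X^r ->
  \prod_(x <- s) (1 - (a * x) *: 'X) = 1 - a ^+ r *: 'X^r :> {poly F}.
Proof.
move=> h; suff sc : coef_scaled a (\prod_(x <- s) (1 - x *: 'X))
    (\prod_(x <- s) (1 - (a * x) *: 'X)).
  apply/polyP => i; rewrite sc h !coefB coef1 coefZ coefXn mulrBr.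
  case: eqP => [->|_]; first by case: eqP => [<-|]; rewrite !(mulr1, mulr0).
  by case: eqP => [->|]; rewrite ?mulr0.
elim/big_ind2: _ => [i|p1 p2 p1' p2'|i _ k].
- by rewrite coef1; case: eqP => [->|]; rewrite ?expr0 ?mulr0 ?mulr1.
- exact: coef_scaledM.
- rewrite !coefB coef1 !coefZ coefX; case: k => [|[|k]] /=.
  + by rewrite !mulr0 expr0 mul1r.
  + by rewrite expr1 !mulr1 !sub0r mulrN.
  + by rewrite !mulr0 subr0 mulr0.
Qed.

(** The quotient (a;q)_n / (q;q)_n, taken factor by factor so that the recursion in n is
    immediate. *)
Definition qcoef a q n : F := \prod_(j < n) ((1 - a * q ^+ j) / (1 - q ^+ j.+1)).

Lemma qcoefS a q n : 1 - q ^+ n.+1 != 0 ->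
  (1 - q ^+ n.+1) * qcoef a q n.+1 = (1 - a * q ^+ n) * qcoef a q n.
Proof.
by rewrite /qcoef big_ord_recr /=; set P := \prod_(i < n) _ => nz; field.
Qed.

Lemma qcoef0 a q : qcoef a q 0 = 1.
Proof. by rewrite /qcoef big_ord0. Qed.

Definition qtrunc M a q x : {poly F} := \poly_(i < M) (qcoef a q i * x ^+ i).

(* Truncation of the functional equation (1 - x) f(x) = (1 - a x) f(q x) of
   f(x) = (a x; q)_oo / (x; q)_oo. *)
Lemma qtrunc_funeq M a q x : (forall n, 1 - q ^+ n.+1 != 0) ->
  eqmod_Xn M ((1 - x *: 'X) * qtrunc M a q x)
             ((1 - (a * x) *: 'X) * qtrunc M a q (q * x)).
Proof.
move=> nz i iM; rewrite !mulrBl !mul1r !coefB -!scalerAl !coefZ !coefXM.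
case: i iM => [|i] iM /=.
  by rewrite !mulr0 !coef_poly iM expr0 expr0.
rewrite !coef_poly iM (ltnW iM) !exprMn.
have /eqP := qcoefS a (nz i); rewrite -subr_eq0 => /eqP e.
apply/eqP; rewrite -subr_eq0; apply/eqP.
transitivity (x ^+ i.+1 * ((1 - q ^+ i.+1) * qcoef a q i.+1
   - (1 - a * q ^+ i) * qcoef a q i)); last by rewrite e mulr0.
by rewrite !exprS; ring.
Qed.

(** Since [H] is G(q X), the multiplied functional equation reads, for n < M, (1 - q^n) G_n = (1 -
    a^r q^(n-r)) G_(n-r), with right-hand side 0 when n < r. On multiples of r this is the recursion
    of [qcoef] in base q^r, and G_0 = 1. *)
Lemma coef_prod_qtrunc (s : seq F) M a q r N :
  (0 < r)%N -> (forall n, 1 - q ^+ n.+1 != 0) ->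
  \prod_(x <- s) (1 - x *: 'X) = 1 - 'X^r -> (N < M)%N ->
  (\prod_(x <- s) qtrunc M a q x)`_N =
    if (r %| N)%N then qcoef (a ^+ r) (q ^+ r) (N %/ r) else 0.
Proof.
move=> r0 nz hx; set G := \prod_(x <- s) _; pose H := \prod_(x <- s) qtrunc M a q (q * x).
have sc : coef_scaled q G H.
  rewrite /G /H; elim/big_ind2: _ => [i|p1 p2 p1' p2'|i _ k].
  - by rewrite coef1; case: eqP => [->|]; rewrite ?expr0 ?mulr0 ?mulr1.
  - exact: coef_scaledM.
  - rewrite !coef_poly; case: ifP; last by rewrite mulr0.
    by rewrite exprMn mulrCA.
have fe : eqmod_Xn M ((1 - 'X^r) * G) ((1 - a ^+ r *: 'X^r) * H).
  rewrite -(prod_1subX_scale a hx) -hx /G /H -!big_split /=.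
  elim/big_ind2: _ => [//|p1 p2 p1' p2'|i _]; first exact: eqmod_XnM.
  exact: qtrunc_funeq.
have rec n : (n < M)%N -> (1 - q ^+ n) * G`_n =
    if (n < r)%N then 0 else (1 - (a ^+ r) * q ^+ (n - r)) * G`_(n - r).
  move=> nM; have := fe n nM; rewrite !mulrBl !mul1r !coefB -!scalerAl !coefZ.
  rewrite !coefXnM !sc; case: ltnP => _ e; apply/eqP; rewrite -subr_eq0; apply/eqP.
    move: e.  by rewrite mulr0 !subr0 => {1}->; rewrite subrr.
  by move/eqP: e; rewrite -subr_eq0 => /eqP e; rewrite -[RHS]e; ring.
elim/ltn_ind: N => -[_|N IH] NM.
  rewrite dvdn0 div0n qcoef0 /G; elim/big_ind: _ => [|p1 p2 h1 h2|i _].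
  - by rewrite coef1.
  - by rewrite coef0M h1 h2 mulr1.
  - by rewrite coef_poly NM qcoef0 expr0 mulr1.
apply: (mulfI (nz N)); rewrite (rec _ NM); case: ltnP => Nr.
  by rewrite gtnNdvd // mulr0.
have -> : (r %| N.+1)%N = (r %| N.+1 - r)%N by rewrite dvdn_subl.
rewrite IH; [|lia|lia]; case: ifP => [rN|]; last by rewrite !mulr0.
have -> : (N.+1 %/ r = ((N.+1 - r) %/ r).+1)%N.
  by rewrite -{1}(subnK Nr) divnDr // divnn r0 addn1.
have eN : N.+1 = (((N.+1 - r) %/ r).+1 * r)%N by rewrite mulSn divnK // subnKC.
have e2 : (N.+1 - r = ((N.+1 - r) %/ r) * r)%N by rewrite divnK.
set k := (_ %/ r)%N in eN e2 *.
have q1 : q ^+ N.+1 = (q ^+ r) ^+ k.+1 by rewrite eN mulnC exprM.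
have q2 : q ^+ (N.+1 - r) = (q ^+ r) ^+ k by rewrite e2 mulnC exprM.
by rewrite q1 q2 qcoefS // -q1.
Qed.

Lemma qtrunc_sum_monomials M a q x :
  qtrunc M a q x = \sum_(j < M) (qcoef a q j * x ^+ j) *: 'X^j.
Proof. by rewrite /qtrunc poly_def. Qed.

(** Distributivity turns the product into a sum of monomials indexed by exponent tuples, and
    exchanging sums keeps those of total degree below L. The factor at [w] stays apart because its
    index n becomes that of the inner series. *)
Lemma weighted_coef_sum m (x : 'I_m -> F) (w : F) M L a q (rho : nat -> F) :
  (L <= M)%N ->
  \sum_(N < L) (\prod_(y <- w :: [seq x i | i <- enum 'I_m]) qtrunc M a q y)`_N * rho N
  = \sum_(f : {ffun 'I_m -> 'I_M}) \sum_(n < M | (\sum_i f i + n < L)%N)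
      (\prod_i (qcoef a q (f i) * x i ^+ f i)) * (qcoef a q n * w ^+ n) *
      rho (\sum_i f i + n)%N.
Proof.
move=> LM; rewrite big_cons big_map big_enum /= mulrC qtrunc_sum_monomials.
under [X in X * _]eq_bigr do rewrite qtrunc_sum_monomials.
rewrite bigA_distr_bigA /= mulr_suml.
under [LHS]eq_bigr => N _ do rewrite coef_sum mulr_suml.
rewrite exchange_big; apply: eq_bigr => f _ /=.
under [LHS]eq_bigr => N _ do rewrite mulr_sumr coef_sum mulr_suml.
rewrite exchange_big [RHS]big_mkcond; apply: eq_bigr => n _ /=.
have -> : \prod_(i < m) ((qcoef a q (f i) * x i ^+ f i) *: 'X^(f i)) =
   (\prod_(i < m) (qcoef a q (f i) * x i ^+ f i)) *: 'X^(\sum_i f i) :> {poly F}.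
  by rewrite scaler_prod; congr (_ *: _); rewrite (big_morph _ (exprD _) (expr0 _)).
under eq_bigr => N _ do rewrite -scalerAl -scalerAr scalerA -exprD coefZ coefXn.
case: ltnP => hL.
  rewrite (bigD1 (Ordinal hL)) //= eqxx mulr1 [X in _ + X]big1 ?addr0 // => N.
  by rewrite -val_eqE /= => /negbTE ->; rewrite mulr0 mul0r.
rewrite big1 // => N _; case: eqP => [e|_]; last by rewrite mulr0 mul0r.
by have := ltn_ord N; rewrite {1}e ltnNge hL.
Qed.

End QBinomialCoefficients.

(** * Convergence of complex sequences and series *)

Section ComplexSeries.
Variable R : realType.
Local Notation C := R[i].
Implicit Types (u : nat -> C) (M v : R).

Lemma Re_normE (z : C) : (complex.Re `|z|)%:C = `|z|.
Proof. exact/RRe_real/normr_real. Qed.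

Lemma normC_realE (x : R) : `|x%:C| = `|x|%:C.
Proof. by rewrite normc_def /= expr0n addr0 sqrtr_sqr. Qed.

Lemma normC_le_ReIm (z : C) : `|z| <= (`|complex.Re z| + `|complex.Im z|)%:C.
Proof.
rewrite {1}(complexE z) (le_trans (ler_normD _ _)) // normrM !normC_realE.
have -> : `|'i%C : C| = 1 by rewrite normc_def /= expr0n expr1n add0r sqrtr1.
by rewrite mul1r rmorphD.
Qed.

Lemma cvg_complex u (x y : R) :
  complex.Re (u n) @[n --> \oo] --> x ->
  complex.Im (u n) @[n --> \oo] --> y ->
  (u : nat -> C^o) n @[n --> \oo] --> (x +i* y : C^o).
Proof.
move=> hx hy; apply/(@cvgrPdist_lt C C^o) => e e0.
have eE : e = (complex.Re e)%:C by rewrite RRe_real // gtr0_real.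
have e'0 : 0 < complex.Re e / 2 by rewrite divr_gt0 // -ltcR -eE.
move/cvgrPdist_lt: hx => /(_ _ e'0) hx; move/cvgrPdist_lt: hy => /(_ _ e'0) hy.
near=> n; rewrite (le_lt_trans (normC_le_ReIm _)) // eE ltcR.
have h1 : `|x - complex.Re (u n)| < complex.Re e / 2 by near: n.
have h2 : `|y - complex.Im (u n)| < complex.Re e / 2 by near: n.
have -> : complex.Re (x +i* y - u n) = x - complex.Re (u n) by case: (u n).
have -> : complex.Im (x +i* y - u n) = y - complex.Im (u n) by case: (u n).
by lra.
Unshelve. all: by end_near.
Qed.

Lemma Re_sum (I : Type) (s : seq I) (P : pred I) (f : I -> C) :
  complex.Re (\sum_(i <- s | P i) f i) = \sum_(i <- s | P i) complex.Re (f i).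
Proof. by apply: (big_morph (@complex.Re R)) => // -[? ?] [? ?]. Qed.

Lemma Im_sum (I : Type) (s : seq I) (P : pred I) (f : I -> C) :
  complex.Im (\sum_(i <- s | P i) f i) = \sum_(i <- s | P i) complex.Im (f i).
Proof. by apply: (big_morph (@complex.Im R)) => // -[? ?] [? ?]. Qed.

(** Real and imaginary parts converge absolutely by comparison with the geometric series. *)
Lemma cvg_series_geometric_bound u M v : 0 <= v < 1 ->
  (forall n, `|u n| <= (M * v ^+ n)%:C) -> cvgn (series (u : nat -> C^o)).
Proof.
move=> /andP[v0 v1] ule.
have M0 : 0 <= M.
  by have := le_trans (normr_ge0 _) (ule 0); rewrite expr0 mulr1 lecR.
have cv (w : nat -> R) : (forall n, `|w n|%:C <= `|u n|) -> cvgn (series w).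
  move=> wu; apply: normed_cvg.
  apply: (@series_le_cvg _ _ (geometric M v)) => [n|n|n|].
  - exact: normr_ge0.
  - by rewrite /geometric /= mulr_ge0 // exprn_ge0.
  - by rewrite -lecR (le_trans (wu n)).
  - by apply: is_cvg_geometric_series; rewrite ger0_norm.
have /cv hx n : `|complex.Re (u n)|%:C <= `|u n| by exact: normc_ge_Re.
have /cv hy n : `|complex.Im (u n)|%:C <= `|u n|.
  by rewrite !normc_def lecR -sqrtr_sqr ler_wsqrtr // lerDr sqr_ge0.
apply/cvg_ex; eexists; apply: cvg_complex.
- rewrite (_ : (fun n => _) = series (fun n => complex.Re (u n))); first exact: hx.
  by apply/funext => n; rewrite /= Re_sum.
- rewrite (_ : (fun n => _) = series (fun n => complex.Im (u n))); first exact: hy.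
  by apply/funext => n; rewrite /= Im_sum.
Qed.

Lemma cvg_finite_sum (I : Type) (s : seq I) (f : I -> nat -> C^o) (l : I -> C^o) :
  (forall i, f i n @[n --> \oo] --> l i) ->
  (\sum_(i <- s) f i n) @[n --> \oo] --> \sum_(i <- s) l i.
Proof.
move=> fl; elim: s => [|i s IH].
  by rewrite big_nil; under eq_fun do rewrite big_nil; exact: cvg_cst.
rewrite big_cons; under eq_fun do rewrite big_cons.
exact: (@cvgD C C^o _ _ _ _ _ _ _ (fl i) IH).
Qed.

End ComplexSeries.

(** * Unconditional summation of an iterated series by total degree *)

Section MultipleSeries.
Variables (R : realType) (m : nat).
Local Notation C := R[i].

Definition nat_ffun M (f : {ffun 'I_m -> 'I_M}) : {ffun 'I_m -> nat} :=
  [ffun i => f i : nat].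

Lemma ksum_nat_ffun M (f : {ffun 'I_m -> 'I_M}) :
  ksum (nat_ffun f) = (\sum_i f i)%N.
Proof. by apply: eq_bigr => i _; rewrite ffunE. Qed.

Lemma nat_ffun_inj M : injective (@nat_ffun M).
Proof.
move=> f g /ffunP fg; apply/ffunP => i; apply/val_inj.
by have := fg i; rewrite !ffunE.
Qed.

Lemma nat_ffun_ex M (k : {ffun 'I_m -> nat}) : (forall i, (k i < M)%N) ->
  exists f : {ffun 'I_m -> 'I_M}, nat_ffun f = k.
Proof.
by move=> kM; exists [ffun i => Ordinal (kM i)]; apply/ffunP => i; rewrite !ffunE.
Qed.

Lemma leq_ksum (k : {ffun 'I_m -> nat}) i : (k i <= ksum k)%N.
Proof. by rewrite /ksum (bigD1 i) //= leq_addr. Qed.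

Lemma partial_sum_nat_ffun M (A : {fset {ffun 'I_m -> nat}})
    (h : {ffun 'I_m -> nat} -> C) :
  (forall k, k \in A -> forall i, (k i < M)%N) ->
  \sum_(k <- A) h k = \sum_(f : {ffun 'I_m -> 'I_M} | nat_ffun f \in A) h (nat_ffun f).
Proof.
pose P := [pred f : {ffun 'I_m -> 'I_M} | nat_ffun f \in A] => AM.
rewrite -(big_image _ _ _ P); apply/perm_big/uniq_perm; first exact: fset_uniq.
  by rewrite (map_inj_uniq (@nat_ffun_inj M)) enum_uniq.
move=> k; apply/idP/fintype.imageP => [kA|[f fA ->]//].
by have [f fk] := nat_ffun_ex (AM k kA); exists f; rewrite ?inE fk.
Qed.

Lemma geometric_sum_le (s : R) n : 0 <= s < 1 -> \sum_(i < n) s ^+ i <= (1 - s)^-1.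
Proof.
move=> /andP[s0 s1]; have s1' : 0 < 1 - s by rewrite subr_gt0.
rewrite -[leRHS]mul1r ler_pdivlMr //.
have -> : (\sum_(i < n) s ^+ i) * (1 - s) = 1 - s ^+ n.
  by rewrite mulrC -opprB mulNr -subrX1 opprB.
by rewrite gerBl exprn_ge0.
Qed.

(** The left-hand side factors as the (m+1)-st power of a finite geometric sum. *)
Lemma geometric_multisum_le (s : R) n : 0 <= s < 1 ->
  \sum_(f : {ffun 'I_m -> 'I_n}) \sum_(j < n) s ^+ (ksum (nat_ffun f) + j)
  <= (1 - s)^-1 ^+ m.+1.
Proof.
move=> s01; have [s0 _] := andP s01.
have g0 : 0 <= \sum_(i < n) s ^+ i by apply: sumr_ge0 => i _; exact: exprn_ge0.
rewrite (_ : \sum_f _ = (\sum_(i < n) s ^+ i) ^+ m.+1).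
  have gs := geometric_sum_le n s01.
  by apply: lerXn2r; rewrite ?nnegrE // (le_trans g0).
rewrite exprSr -[in RHS](card_ord m) -prodr_const bigA_distr_bigA mulr_suml.
apply: eq_bigr => f _; rewrite mulr_sumr; apply: eq_bigr => j _.
by rewrite exprD ksum_nat_ffun (big_morph _ (exprD _) (expr0 _)).
Qed.

(** [U k n] is the term with outer multi-index k and inner index n, and [g N] collects the terms of
    total degree N. The square in [U_le] leaves one factor s^N to make the tail small and another to
    sum it. *)
Variables (U : {ffun 'I_m -> nat} -> nat -> C) (g : nat -> C) (B s : R).
Hypothesis s01 : 0 <= s < 1.
Hypothesis U_le : forall k n, `|U k n| <= (B * (s ^+ (ksum k + n)) ^+ 2)%:C.
Hypothesis U_diag : forall L M, (L <= M)%N ->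
  \sum_(N < L) g N = \sum_(f : {ffun 'I_m -> 'I_M})
     \sum_(n < M | (ksum (nat_ffun f) + n < L)%N) U (nat_ffun f) n.

(** Terms of total degree below L occur in both sums and cancel. Every other term has degree N >= L,
    hence norm at most B s^(2N) <= B s^L s^N, and the factors s^N are summed over the whole box. *)
Lemma diag_partial_sum_dist L M (A : {fset {ffun 'I_m -> nat}}) : (L <= M)%N ->
  (forall k, k \in A -> forall i, (k i < M)%N) ->
  (forall k, (ksum k < L)%N -> k \in A) ->
  `|\sum_(N < L) g N - \sum_(k <- A) \sum_(n < M) U k n|
    <= (B * s ^+ L * (1 - s)^-1 ^+ m.+1)%:C.
Proof.
move=> LM AM AL; have [s0 s1] := andP s01.
have B0 : 0 <= B.
  have := le_trans (normr_ge0 _) (U_le [ffun=> 0%N] 0).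
  rewrite /ksum big1 => [|i _]; last by rewrite ffunE.
  by rewrite expr0 expr1n mulr1 lecR.
rewrite (U_diag LM) (partial_sum_nat_ffun _ AM) [X in _ - X]big_mkcond -sumrB.
have le1 (f : {ffun 'I_m -> 'I_M}) :
    `|\sum_(n < M | (ksum (nat_ffun f) + n < L)%N) U (nat_ffun f) n
    - (if nat_ffun f \in A then \sum_(n < M) U (nat_ffun f) n else 0)|
    <= (\sum_(n < M) B * s ^+ L * s ^+ (ksum (nat_ffun f) + n))%:C.
  set k := nat_ffun f.
  rewrite (_ : (if _ then _ else _) =
    \sum_(n < M) if k \in A then U k n else 0); last first.
    by case: ifP => // _; rewrite big1.
  rewrite big_mkcond -sumrB rmorph_sum (le_trans (ler_norm_sum _ _ _)) //.
  apply: ler_sum => n _ /=; set N := (_ + _)%N.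
  have pos : 0 <= B * s ^+ L * s ^+ N by rewrite !mulr_ge0 ?exprn_ge0.
  case: ltnP => hN.
    by rewrite AL ?subrr ?normr0 ?lecR // (leq_ltn_trans _ hN) // leq_addr.
  rewrite sub0r normrN; case: ifP => _; last by rewrite normr0 lecR.
  rewrite (le_trans (U_le _ _)) // lecR expr2 mulrA ler_wpM2r ?exprn_ge0 //.
  by rewrite ler_wpM2l // ler_wiXn2l // ltW.
rewrite (le_trans (ler_norm_sum _ _ _)) // (le_trans (ler_sum _ (fun f _ => le1 f))) //.
rewrite -rmorph_sum lecR; under eq_bigr do rewrite -mulr_sumr.
by rewrite -mulr_sumr ler_wpM2l ?mulr_ge0 ?exprn_ge0 ?geometric_multisum_le.
Qed.

(** The sums of [g] are needed only up to multiples of r, where they are partial sums of the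
    left-hand series. *)
Lemma multisum_limn r (S : C) : (0 < r)%N ->
  (forall k, cvgn (series (U k : nat -> C^o))) ->
  ((\sum_(N < r * L) g N) : C^o) @[L --> \oo] --> (S : C^o) ->
  multisum (fun k => limn (series (U k : nat -> C^o))) S.
Proof.
move=> r0 Ucv gS; have [s0 s1] := andP s01.
apply/(@cvgrPdist_lt C C^o _ _ totally_filter) => e e0.
have eE : e = (complex.Re e)%:C by rewrite RRe_real // gtr0_real.
have e30 : 0 < e / 3 by rewrite divr_gt0.
have e'0 : 0 < complex.Re e / 3 by rewrite divr_gt0 // -ltcR -eE.
have e3E : e / 3 = (complex.Re e / 3)%:C.
  by rewrite {1}eE rmorphM fmorphV rmorph_nat.
have /cvgrPdist_lt/(_ _ e'0) sL :
    (B * s ^+ L * (1 - s)^-1 ^+ m.+1) @[L --> \oo] --> (B * 0 * (1 - s)^-1 ^+ m.+1).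
  apply: cvgMr_tmp; apply: cvgMl_tmp; apply: cvg_expr.
  by rewrite ger0_norm.
have {}sL : \forall L \near \oo, `|B * 0 * (1 - s)^-1 ^+ m.+1 -
     B * s ^+ (r * L) * (1 - s)^-1 ^+ m.+1| < complex.Re e / 3.
  exact: (@cvg_mulnl r r0 _ sL).
move/(@cvgrPdist_lt C C^o): gS => /(_ _ e30) gS.
near \oo => L.
have gL : `|S - \sum_(N < r * L) g N| < e / 3 by near: L.
have sL' : (B * s ^+ (r * L) * (1 - s)^-1 ^+ m.+1)%:C < e / 3.
  rewrite e3E ltcR; suff : `|B * 0 * (1 - s)^-1 ^+ m.+1 -
     (B * s ^+ (r * L) * (1 - s)^-1 ^+ m.+1)| < complex.Re e / 3.
    by rewrite mulr0 mul0r sub0r normrN; apply: le_lt_trans; exact: ler_norm.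
  by near: L.
(* The box of side r L contains every k with [ksum k] < r L. *)
pose A0 := [fset k in [seq nat_ffun f | f : {ffun 'I_m -> 'I_(r * L)}]]%fset.
exists A0 => // A /= A0A.
have AL k : (ksum k < r * L)%N -> k \in A.
  move=> kL; apply: (fsubsetP A0A).
  have [i|f <-] := @nat_ffun_ex (r * L) k.
    exact: leq_ltn_trans (leq_ksum k i) kL.
  by rewrite inE /=; apply/fintype.imageP; exists f.
have /(@cvgrPdist_lt C C^o)/(_ _ e30) AU :
    ((\sum_(k <- A) series (U k : nat -> C^o) n) : C^o) @[n --> \oo] -->
    ((\sum_(k <- A) limn (series (U k : nat -> C^o))) : C^o).
  by apply: cvg_finite_sum => k; exact: Ucv.
(* M depends on A: it bounds all entries of members of A, and the inner sums cut at M are close to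
   their limits. *)
near \oo => M.
have LM : (r * L <= M)%N by near: M; exact: nbhs_infty_ge.
have AM k : k \in A -> forall i, (k i < M)%N.
  move=> kA i; apply: (@leq_trans (\sum_(k <- A) ksum k).+1).
    by rewrite ltnS (leq_trans (leq_ksum k i)) // (big_rem k) //= leq_addr.
  by near: M; exact: nbhs_infty_ge.
have := diag_partial_sum_dist LM AM AL; set G := \sum_(N < _) _ in gL *.
set V := \sum_(k <- A) _ => GV.
have AU' : `|(\sum_(k <- A) limn (series (U k : nat -> C^o))) - V| < e / 3.
  rewrite /V; under [X in _ - X]eq_bigr => k _ do rewrite -(big_mkord xpredT (U k)).
  by near: M.
rewrite /partial_sum -(big_seq_fsetE _ _ xpredT
  (fun k => limn (series (U k : nat -> C^o)))) /=.
set W := \sum_(k <- A) _ in AU' *.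
(* One third of [e] each: the tail of the sum of [g], the terms of high degree, and the truncation
   of the inner series. *)
have -> : S - W = (S - G) + (G - V) - (W - V) by ring.
rewrite (le_lt_trans (ler_normB _ _)) // (le_lt_trans (lerD (ler_normD _ _) (lexx _))) //.
have -> : e = e / 3 + e / 3 + e / 3 by field.
by rewrite ltrD // ltrD // (le_lt_trans GV).
Unshelve. all: by end_near.
Qed.

End MultipleSeries.

(** * The complex exponential, real powers of q and roots of unity *)

Section Exponential.
Variable R : realType.
Local Notation C := R[i].
Implicit Types (z lq : C) (x y : R).

Lemma expCD z z' : expC (z + z') = expC z * expC z'.
Proof.
case: z z' => [a b] [c d]; rewrite /expC /= expRD cosD sinD.
by apply/eqP; rewrite eq_complex /=; apply/andP; split; apply/eqP; ring.
Qed.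

Lemma expC0 : expC (0 : C) = 1.
Proof. by rewrite /expC /= expR0 cos0 sin0 mul1r. Qed.

Lemma expC_natr n z : expC (n%:R * z) = expC z ^+ n.
Proof.
elim: n => [|n IH]; first by rewrite mul0r expC0.
by rewrite -natr1 mulrDl mul1r expCD IH exprSr.
Qed.

Lemma norm_expC z : `|expC z| = (expR (complex.Re z))%:C.
Proof.
rewrite /expC normrM normC_realE (ger0_norm (expR_ge0 _)).
by rewrite (normc_def (_ +i* _)) /= cos2Dsin2 sqrtr1 mulr1.
Qed.

Lemma qpowD lq x y : qpow lq (x + y) = qpow lq x * qpow lq y.
Proof. by rewrite /qpow rmorphD mulrDl expCD. Qed.

Lemma qpow0 lq : qpow lq 0 = 1.
Proof. by rewrite /qpow mul0r expC0. Qed.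

Lemma qpowMn lq x n : qpow lq (x * n%:R) = qpow lq x ^+ n.
Proof. by rewrite /qpow -expC_natr rmorphM rmorph_nat -mulrA mulrCA. Qed.

Lemma qpow_natrM lq x n : qpow (n%:R * lq) x = qpow lq (n%:R * x).
Proof. by rewrite /qpow rmorphM rmorph_nat mulrCA mulrA. Qed.

Lemma norm_qpow lq x : `|qpow lq x| = (expR (x * complex.Re lq))%:C.
Proof. by case: lq => a b; rewrite /qpow norm_expC /= mul0r subr0. Qed.

Lemma Re_log_lt0 lq : `|expC lq| < 1 -> complex.Re lq < 0.
Proof. by rewrite norm_expC -[1]/(1%:C) ltcR expR_lt1. Qed.

Lemma norm_zetaC r : `|zetaC R r| = 1.
Proof. by rewrite /zetaC norm_expC /= expR0. Qed.

Lemma zetaC_prim r : (0 < r)%N -> r.-primitive_root (zetaC R r).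
Proof.
move=> r0; have rR : 0 < r%:R :> R by rewrite ltr0n.
have zetaX k : zetaC R r ^+ k =
    cos (pi * (k%:R / r%:R) *+ 2) +i* sin (pi * (k%:R / r%:R) *+ 2).
  rewrite /zetaC -expC_natr /expC -(rmorph_nat (real_complex R)) /=.
  rewrite !(mul0r, mulr0, subr0, expR0, mul1r) addr0.
  by congr (cos _ +i* sin _); field; rewrite lt0r_neq0.
apply/andP; split => //; apply/forallP => i; apply/eqP; rewrite unity_rootE zetaX.
case: (ltnP i.+1 r) => ir.
  (* A lower power differs from 1 in its real part: cos (2 y) < 1 because 0 < y < pi. *)
  rewrite [RHS]ltn_eqF //; apply/negbTE; rewrite eq_complex negb_and /=.
  apply/orP; left; rewrite mulr2n cosD -!expr2 cos2sin2 lt_eqF //.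
  set y := pi * _; suff : 0 < sin y by nra.
  apply: sin_gt0_pi; rewrite mulr_gt0 ?pi_gt0 ?divr_gt0 //=.
  by rewrite gtr_pMr ?pi_gt0 // ltr_pdivrMr // mul1r ltr_nat.
have -> : i.+1 = r by apply/eqP; rewrite eqn_leq ir ltn_ord.
by rewrite divff ?lt0r_neq0 // mulr1 -mulr_natl mulrC mulr_natr cos2pi sin2pi !eqxx.
Qed.

End Exponential.

(** Each factor is -z^i (X - z^(-i)), and z^(-1) = z^(r-1) is again primitive, so the product is c
    (X^r - 1). Evaluation at 0 gives c = -1. *)
Lemma prod_1sub_zeta (F : fieldType) r (z : F) : r.-primitive_root z ->
  \prod_(i < r) (1 - z ^+ i *: 'X) = 1 - 'X^r.
Proof.
move=> zr; have r0 := prim_order_gt0 zr.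
have zr' : r.-primitive_root (z ^+ r.-1).
  rewrite (prim_root_exp_coprime _ zr); case: r r0 {zr} => // r _ /=.
  exact: coprimenS.
have := factor_Xn_sub_1 zr'; rewrite big_mkord => fac.
have e (i : 'I_r) : 1 - z ^+ i *: 'X = (- z ^+ i) *: ('X - ((z ^+ r.-1) ^+ i)%:P).
  rewrite scalerBr !scaleNr opprK -mul_polyC -mul_polyC -polyCM -exprMn -exprS.
  by rewrite prednK // (prim_expr_order zr) expr1n addrC.
rewrite (eq_bigr _ (fun i _ => e i)) scaler_prod fac.
set c := \prod_(i < r) - z ^+ i.
have : (\prod_(i < r) (1 - z ^+ i *: 'X)).[0] = 1.
  by rewrite horner_prod big1 // => i _; rewrite !hornerE subr0.
rewrite (eq_bigr _ (fun i _ => e i)) scaler_prod fac -/c !hornerE.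
rewrite expr0n gtn_eqF // sub0r mulrN1 => cE.
by rewrite -[c]opprK cE scaleN1r opprB.
Qed.

(** * Bounds for the q-binomial coefficients and the Gaussian weights *)

Section Bounds.
Variable R : realType.
Local Notation C := R[i].

Lemma Re_norm_ge0 (z : C) : 0 <= complex.Re `|z|.
Proof. by rewrite normc_def /= sqrtr_ge0. Qed.

Lemma expr_neq1 (q : C) n : `|q| < 1 -> 1 - q ^+ n.+1 != 0.
Proof.
move=> q1; rewrite subr_eq0; apply/eqP => e.
by have := exprn_ilt1 (n.+1) (normr_ge0 q) q1; rewrite -normrX -e normr1 ltxx.
Qed.

(* |1 - a q^n| / |1 - q^(n+1)| <= exp (E |q|^n) with E = |a| + 1 / (1 - |q|), and
   these bounds multiply to at most exp (E / (1 - |q|)). *)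
Lemma qcoef_bounded (a q : C) : `|q| < 1 ->
  exists2 D : R, 0 <= D & forall n, `|qcoef a q n| <= D%:C.
Proof.
move=> q1; pose Q := complex.Re `|q|; pose A := complex.Re `|a|.
have QE : `|q| = Q%:C by rewrite Re_normE.
have AE : `|a| = A%:C by rewrite Re_normE.
have Q0 : 0 <= Q by exact: Re_norm_ge0.
have A0 : 0 <= A by exact: Re_norm_ge0.
have Q1 : Q < 1 by rewrite -ltcR -QE.
pose E := A + (1 - Q)^-1.
have iQ : 0 < (1 - Q)^-1 by rewrite invr_gt0 subr_gt0.
have E0 : 0 <= E by rewrite addr_ge0 // ltW.
have step n : 1 + A * Q ^+ n <= expR (E * Q ^+ n) * (1 - Q ^+ n.+1).
  set y := Q ^+ n; have y0 : 0 <= y by exact: exprn_ge0.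
  have y1 : y <= 1 by rewrite exprn_ile1 // ltW.
  have yQ : 0 <= 1 - Q * y by nra.
  rewrite /E mulrDl expRD -mulrA exprS -/y.
  have h1 := expR_ge1Dx (A * y); have h2 := expR_ge1Dx ((1 - Q)^-1 * y).
  rewrite -[leLHS]mulr1 ler_pM ?addr_ge0 ?mulr_ge0 //.
  rewrite (le_trans _ (ler_wpM2r yQ h2)) //.
  (* The summand 1 / (1 - Q) of [E] absorbs the denominator: y <= 1 gives (1 - Q y) / (1 - Q) >= 1
     >= Q. *)
  have -> : (1 + (1 - Q)^-1 * y) * (1 - Q * y) =
     1 + y * ((1 - Q * y) / (1 - Q) - Q).
    by field; rewrite subr_eq0 gt_eqF.
  rewrite lerDl mulr_ge0 // subr_ge0 ler_pdivlMr ?subr_gt0 //.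
  by nra.
have main n : `|qcoef a q n| <= (expR (E * \sum_(i < n) Q ^+ i))%:C.
  elim: n => [|n IH]; first by rewrite qcoef0 big_ord0 mulr0 expR0 normr1.
  have p : 0 < 1 - Q ^+ n.+1 by rewrite subr_gt0 exprn_ilt1.
  have p' : 0 < (1 - Q ^+ n.+1)%:C :> C by rewrite ltcR.
  rewrite -(ler_pM2r p').
  apply: (@le_trans _ _ (`|qcoef a q n.+1| * `|1 - q ^+ n.+1|)).
    rewrite ler_wpM2l // (le_trans _ (lerB_dist _ _)) //.
    by rewrite normr1 normrX QE rmorphB rmorphXn.
  rewrite -normrM mulrC (qcoefS a (expr_neq1 n q1)) normrM mulrC.
  have -> : (expR (E * \sum_(i < n.+1) Q ^+ i))%:C * (1 - Q ^+ n.+1)%:C =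
      (expR (E * \sum_(i < n) Q ^+ i))%:C *
      (expR (E * Q ^+ n) * (1 - Q ^+ n.+1))%:C :> C.
    by rewrite big_ord_recr /= mulrDr expRD !rmorphM mulrA.
  rewrite ler_pM //.
  apply: (@le_trans _ _ (1 + A * Q ^+ n)%:C); last by rewrite lecR step.
  rewrite (le_trans (ler_normB _ _)) // normr1 normrM normrX AE QE.
  by rewrite rmorphD rmorphM rmorphXn.
exists (expR (E * (1 - Q)^-1)) => [|n]; first exact: expR_ge0.
rewrite (le_trans (main n)) // lecR ler_expR ler_wpM2l //.
by rewrite geometric_sum_le ?Q0.
Qed.

(** For alpha = 0 the weight is itself geometric with ratio |t| < 1. For alpha > 0 the factor exp
    (-b n^2) beats any exponential, by completing the square. *)
Lemma gaussian_weight_bound (lq t : C) (alpha : R) :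
  complex.Re lq < 0 -> 0 <= alpha -> (alpha = 0 -> `|t| < 1) ->
  exists M v : R, 0 <= v < 1 /\
    forall n, `|qpow lq (alpha * n%:R ^+ 2) * t ^+ n| <= (M * v ^+ n)%:C.
Proof.
move=> lq0 al0 ht; pose T := complex.Re `|t|.
have TE : `|t| = T%:C by rewrite Re_normE.
have T0 : 0 <= T by exact: Re_norm_ge0.
have wE n : `|qpow lq (alpha * n%:R ^+ 2) * t ^+ n| =
    (expR (alpha * complex.Re lq * n%:R ^+ 2) * T ^+ n)%:C.
  by rewrite normrM norm_qpow normrX TE rmorphM rmorphXn mulrAC.
have [a0|an0] := eqVneq alpha 0.
  exists 1, T; split; first by rewrite T0 -ltcR -TE ht.
  by move=> n; rewrite wE a0 !mul0r expR0.
pose b := - (alpha * complex.Re lq).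
have b0 : 0 < b by rewrite oppr_gt0 pmulr_rlt0 // lt0r an0.
(* With this [l], 2^(-n) = (T + 1)^n exp (-l n), and l n - b n^2 is at most l^2 / (4 b). Using T + 1
   keeps the logarithm meaningful for t = 0. *)
pose l := ln (2 * (T + 1)).
have T2 : 0 < 2 * (T + 1) by lra.
exists (expR (l ^+ 2 / (4 * b))), 2^-1; split.
  by apply/andP; split; lra.
move=> n; rewrite wE lecR.
have -> : 2^-1 ^+ n = (T + 1) ^+ n * expR (- (l * n%:R)).
  rewrite expRN mulrC; apply: (canRL (mulKf _)); first by rewrite gt_eqF ?expR_gt0.
  rewrite mulrC expRM_natr lnK ?posrE // -exprMn; by congr (_ ^+ _); lra.
rewrite [leLHS]mulrC [leRHS]mulrCA ler_pM ?exprn_ge0 ?expR_ge0 //.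
  by rewrite lerXn2r ?nnegrE //; lra.
rewrite -expRD ler_expR.
have -> : alpha * complex.Re lq * n%:R ^+ 2 = - (b * n%:R ^+ 2) by rewrite /b mulNr opprK.
rewrite -subr_ge0.
have -> : l ^+ 2 / (4 * b) - l * n%:R - - (b * n%:R ^+ 2) =
   (2 * b * n%:R - l) ^+ 2 / (4 * b) by field; rewrite gt_eqF.
by rewrite divr_ge0 ?sqr_ge0 // mulr_ge0 // ltW.
Qed.

End Bounds.

(** * Terms and convergence of the series A_q *)

Lemma qcoefE (R : realType) (a q : R[i]) n :
  qcoef a q n = qpoch a q n / qpoch q q n.
Proof. by rewrite /qcoef prodf_div; under [X in _ / X]eq_bigr do rewrite exprS. Qed.

Lemma qA_termE (R : realType) (q lq : R[i]) alpha (a t : R[i]) n :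
  qA_term q lq alpha a t n =
  qcoef a q n * (qpow lq (alpha * n%:R ^+ 2) * t ^+ n).
Proof. by rewrite /qA_term qcoefE; ring. Qed.

Lemma qA_convergent (R : realType) (q lq : R[i]) (alpha : R) (a t : R[i]) :
  expC lq = q -> `|q| < 1 -> 0 <= alpha -> (alpha = 0 -> `|t| < 1) ->
  qA_cvg q lq alpha a t.
Proof.
move=> <- q1 alpha0 ht.
have [M [v [v01 wM]]] := gaussian_weight_bound (Re_log_lt0 q1) alpha0 ht.
have [D D0 cD] := qcoef_bounded a q1.
apply: (cvg_series_geometric_bound v01 (M := D * M)) => n.
by rewrite qA_termE normrM -mulrA rmorphM ler_pM.
Qed.

(** * The multisection identity with any one root of unity split off *)

Section Multisection.
Variables (R : realType) (q lq : R[i]) (alpha : R) (r : nat) (a t : R[i]).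
Local Notation C := R[i].
Hypotheses (hlq : expC lq = q) (q_lt1 : `|q| < 1) (alpha_ge0 : 0 <= alpha).
Hypotheses (r_gt0 : (0 < r)%N) (ht : alpha = 0 -> `|t| < 1).

Let weight N : C := qpow lq (alpha * N%:R ^+ 2) * t ^+ N.

Lemma qA_convergent_pow :
  qA_cvg (q ^+ r) (r%:R * lq) (r%:R * alpha) (a ^+ r) (t ^+ r).
Proof.
have rR : r%:R != 0 :> R by rewrite pnatr_eq0 -lt0n.
apply: qA_convergent.
- by rewrite expC_natr hlq.
- by rewrite normrX exprn_ilt1 // -lt0n.
- by rewrite mulr_ge0.
- move=> /eqP; rewrite mulf_eq0 (negbTE rR) => /eqP /ht t1.
  by rewrite normrX exprn_ilt1 // -lt0n.
Qed.

(** For alpha = 0 the factor q^(2 alpha n) is 1, so the new argument still has norm |t| < 1. *)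
Lemma qA_convergent_twist (w : C) n : `|w| = 1 ->
  qA_cvg q lq alpha a (w * qpow lq (2 * alpha * n%:R) * t).
Proof.
move=> w1; apply: qA_convergent => // a0.
by rewrite a0 mulr0 mul0r qpow0 mulr1 normrM w1 mul1r ht.
Qed.

(* (k + n)^2 = k^2 + n^2 + 2 k n turns the Gaussian weight of the total degree
   into the parameter q^(2 alpha k) of the inner series. *)
Lemma weightD k n :
  weight (k + n) = weight k * (qpow lq (alpha * n%:R ^+ 2) *
     (qpow lq (2 * alpha * k%:R) * t) ^+ n).
Proof.
rewrite /weight exprMn -qpowMn exprD.
have -> : alpha * (k + n)%:R ^+ 2 =
    alpha * k%:R ^+ 2 + (alpha * n%:R ^+ 2 + 2 * alpha * k%:R * n%:R).
  by rewrite natrD; ring.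
by rewrite !qpowD; ring.
Qed.

(** The r-th roots of unity are listed as [w], which goes to the inner series, and the [x i], which
    go to the outer indices. *)
Variables (m : nat) (x : 'I_m -> C) (w : C).
Hypothesis roots :
  \prod_(y <- w :: [seq x i | i <- enum 'I_m]) (1 - y *: 'X) = 1 - 'X^r.
Hypotheses (x1 : forall i, `|x i| = 1) (w1 : `|w| = 1).

Let pref (k : {ffun 'I_m -> nat}) : C :=
  \prod_i (qcoef a q (k i) * x i ^+ k i) * weight (ksum k).

Let U (k : {ffun 'I_m -> nat}) n : C :=
  pref k * qA_term q lq alpha a (w * qpow lq (2 * alpha * (ksum k)%:R) * t) n.

Let g N : C :=
  (if (r %| N)%N then qcoef (a ^+ r) (q ^+ r) (N %/ r) else 0) * weight N.

Lemma term_weightE k n :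
  U k n = \prod_i (qcoef a q (k i) * x i ^+ k i) * (qcoef a q n * w ^+ n) *
          weight (ksum k + n).
Proof.
by rewrite /U /pref qA_termE weightD -[w * _ * t]mulrA [in LHS]exprMn; ring.
Qed.

Lemma term_diag L M : (L <= M)%N ->
  \sum_(N < L) g N = \sum_(f : {ffun 'I_m -> 'I_M})
     \sum_(n < M | (ksum (nat_ffun f) + n < L)%N) U (nat_ffun f) n.
Proof.
move=> LM.
transitivity (\sum_(N < L) (\prod_(y <- w :: [seq x i | i <- enum 'I_m])
    qtrunc M a q y)`_N * weight N).
  apply: eq_bigr => N _; rewrite (coef_prod_qtrunc a (q := q) r_gt0 _ roots) //.
    by move=> n; exact: expr_neq1.
  exact: leq_trans (ltn_ord N) LM.
rewrite weighted_coef_sum //; apply: eq_bigr => f _.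
rewrite ksum_nat_ffun; apply: eq_bigr => n _.
rewrite term_weightE ksum_nat_ffun; congr (_ * _ * _).
by apply: eq_bigr => i _; rewrite ffunE.
Qed.

(** Each block of r consecutive indices has one multiple N = r n, and alpha (r n)^2 = r (r alpha
    n^2) matches base q^r with parameter r alpha. *)
Lemma multisection_sum L : \sum_(N < r * L) g N =
  \sum_(n < L) qA_term (q ^+ r) (r%:R * lq) (r%:R * alpha) (a ^+ r) (t ^+ r) n.
Proof.
elim: L => [|L IH]; first by rewrite muln0 !big_ord0.
rewrite big_ord_recr /= -IH mulnS addnC big_split_ord /=; congr (_ + _).
have gE (i : 'I_r) : g (r * L + i) = if i == 0%N :> nat
    then qcoef (a ^+ r) (q ^+ r) L * weight (r * L) else 0.
  rewrite /g dvdn_addr ?dvdn_mulr //; case: eqP => [->|/eqP i0].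
    by rewrite dvdn0 addn0 mulKn.
  by rewrite gtnNdvd ?lt0n // mul0r.
rewrite (eq_bigr _ (fun i _ => gE i)) (bigD1 (Ordinal r_gt0)) //= big1 ?addr0.
  rewrite qA_termE /weight qpow_natrM natrM exprM; congr (_ * (qpow _ _ * _)).
  by ring.
by move=> i; rewrite -val_eqE /= => /negbTE ->.
Qed.

Lemma term_bound : exists B s : R, 0 <= s < 1 /\
  forall k n, `|U k n| <= (B * (s ^+ (ksum k + n)) ^+ 2)%:C.
Proof.
have lq0 : complex.Re lq < 0 by apply: Re_log_lt0; rewrite hlq.
have [M [v [/andP[v0 v1] wM]]] := gaussian_weight_bound lq0 alpha_ge0 ht.
have [D D0 cD] := qcoef_bounded a q_lt1.
(* One [D] bounds each of the m + 1 coefficients; the square root writes v^N as (s^N)^2. *)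
exists (D ^+ m * D * M), (Num.sqrt v); split.
  by rewrite sqrtr_ge0 -sqrtr1 ltr_sqrt.
move=> k n; rewrite -exprM mulnC exprM sqr_sqrtr // term_weightE.
rewrite -[D ^+ m * D * M * _]mulrA 2!rmorphM normrM; apply: ler_pM => //; last exact: wM.
rewrite normrM; apply: ler_pM => //; last first.
  by rewrite normrM normrX w1 expr1n mulr1; exact: cD.
rewrite normr_prod rmorphXn -[m in X in _ <= X]card_ord -prodr_const.
apply: ler_prod => i _; rewrite normr_ge0 normrM normrX x1 expr1n mulr1. exact: cD.
Qed.

Lemma qA_multisection :
  multisum (fun k : {ffun 'I_m -> nat} =>
      (\prod_i qpoch a q (k i)) * (\prod_i x i ^+ k i) *
      qpow lq (alpha * (ksum k)%:R ^+ 2) * t ^+ ksum k /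
      (\prod_i qpoch q q (k i)) *
      qA q lq alpha a (w * qpow lq (2 * alpha * (ksum k)%:R) * t))
    (qA (q ^+ r) (r%:R * lq) (r%:R * alpha) (a ^+ r) (t ^+ r)).
Proof.
have Ulim k : series (U k : nat -> C^o) n @[n --> \oo] -->
    (pref k * qA q lq alpha a (w * qpow lq (2 * alpha * (ksum k)%:R) * t) : C^o).
  rewrite (_ : series _ = fun n => pref k *
    series (qA_term q lq alpha a (w * qpow lq (2 * alpha * (ksum k)%:R) * t)) n).
    apply: (@cvgMl_tmp C); exact: qA_convergent_twist.
  by apply/funext => n; rewrite /series /= mulr_sumr.
rewrite (_ : (fun k => _) = fun k => limn (series (U k : nat -> C^o))).
  have [B [s [s01 Ule]]] := term_bound.
  apply: (multisum_limn s01 Ule term_diag r_gt0).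
    by move=> k; apply/cvg_ex; eexists; exact: Ulim.
  under eq_fun => L do rewrite multisection_sum -(big_mkord xpredT (qA_term _ _ _ _ _)).
  exact: qA_convergent_pow.
apply/funext => k; rewrite (cvg_lim _ (Ulim k)); last exact: norm_hausdorff.
congr (_ * _); rewrite /pref big_split /=.
have -> : \prod_i qcoef a q (k i) =
    (\prod_i qpoch a q (k i)) / \prod_i qpoch q q (k i).
  by rewrite -prodf_div; apply: eq_bigr => i _; exact: qcoefE.
by rewrite /weight; ring.
Qed.

End Multisection.

(** * The two identities, with the root 1 or zeta_r split off *)

Lemma eq_multisum (R : realType) m (f g : {ffun 'I_m -> nat} -> R[i]) (S : R[i]) :
  f =1 g -> multisum f S -> multisum g S.
Proof. by move=> /funext ->. Qed.

(* A multi-index k : 'I_r.-1 -> nat stands for (k_1, .., k_(r-1)) in the first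
   identity, with k i = k_(i+1), and for (k_2, .., k_r) in the second one, with
   k i = k_(i+2).  In the second identity the exponent of zeta_r runs over
   2 <= i+2 <= r-1 only. *)
Theorem theorem2p3 (R : realType) (q lq : R[i]) (hlq : expC lq = q)
    (q_gt0 : 0 < `|q|) (q_lt1 : `|q| < 1)
    (alpha : R) (alpha_ge0 : 0 <= alpha) (r : nat) (r_ge2 : (2 <= r)%N)
    (a t : R[i]) (ht : alpha = 0 -> `|t| < 1) :
  [/\ qA_cvg (q ^+ r) (r%:R * lq) (r%:R * alpha) (a ^+ r) (t ^+ r),
      (forall k : {ffun 'I_r.-1 -> nat},
          qA_cvg q lq alpha a
            (qpow lq (2 * alpha * (ksum k)%:R) * t)) /\
      multisum (fun k : {ffun 'I_r.-1 -> nat} =>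
          (\prod_(i < r.-1) qpoch a q (k i)) *
          zetaC R r ^+ (\sum_(i < r.-1) i.+1 * k i)%N *
          qpow lq (alpha * (ksum k)%:R ^+ 2) *
          t ^+ ksum k /
          (\prod_(i < r.-1) qpoch q q (k i)) *
          qA q lq alpha a
            (qpow lq (2 * alpha * (ksum k)%:R) * t))
        (qA (q ^+ r) (r%:R * lq) (r%:R * alpha) (a ^+ r) (t ^+ r))
    & (forall k : {ffun 'I_r.-1 -> nat},
          qA_cvg q lq alpha a
            (zetaC R r * qpow lq (2 * alpha * (ksum k)%:R) * t)) /\
      multisum (fun k : {ffun 'I_r.-1 -> nat} =>
          (\prod_(i < r.-1) qpoch a q (k i)) *
          zetaC R r ^+ (\sum_(i < r.-1 | (i.+2 < r)%N) i.+2 * k i)%N *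
          qpow lq (alpha * (ksum k)%:R ^+ 2) *
          t ^+ ksum k /
          (\prod_(i < r.-1) qpoch q q (k i)) *
          qA q lq alpha a
            (zetaC R r * qpow lq (2 * alpha * (ksum k)%:R) * t))
        (qA (q ^+ r) (r%:R * lq) (r%:R * alpha) (a ^+ r) (t ^+ r))].
Proof.
case: r r_ge2 => // m m1; set z := zetaC R m.+1; rewrite -[m.+1.-1]/m.
have z1 : `|z| = 1 by exact: norm_zetaC.
have zX1 n : `|z ^+ n| = 1 by rewrite normrX z1 expr1n.
have zprim : m.+1.-primitive_root z by exact: zetaC_prim.
have zr : z ^+ m.+1 = 1 by exact: prim_expr_order.
have roots := prod_1sub_zeta zprim.
split.
- exact: qA_convergent_pow.
- split=> [k|].
    by rewrite -[qpow _ _]mul1r; apply: qA_convergent_twist; rewrite ?normr1.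
  have rs : \prod_(y <- 1 :: [seq z ^+ i.+1 | i : 'I_m <- enum 'I_m]) (1 - y *: 'X) =
      1 - 'X^(m.+1) :> {poly R[i]}.
    by rewrite big_cons big_map big_enum -roots big_ord_recl expr0.
  apply: (eq_multisum _ (qA_multisection (a := a) hlq q_lt1 alpha_ge0
    (ltn0Sn m) ht rs (fun i => zX1 i.+1) (normr1 _))) => k.
  rewrite mul1r (big_morph _ (exprD z) (expr0 z)).
  by under [in RHS]eq_bigr do rewrite exprM.
- split=> [k|]; first exact: qA_convergent_twist.
  (* The outer roots are now z^2, .., z^r, the last being z^r = 1. *)
  have rs : \prod_(y <- z :: [seq z ^+ i.+2 | i : 'I_m <- enum 'I_m]) (1 - y *: 'X) =
      1 - 'X^(m.+1) :> {poly R[i]}.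
    transitivity (\prod_(i < m.+1) (1 - z ^+ i.+1 *: 'X)).
      by rewrite big_cons big_map big_enum big_ord_recl expr1.
    by rewrite -roots big_ord_recr [RHS]big_ord_recl /= zr expr0 mulrC.
  apply: (eq_multisum _ (qA_multisection (a := a) hlq q_lt1 alpha_ge0
    (ltn0Sn m) ht rs (fun i => zX1 i.+2) z1)) => k.
  congr (_ * _ * _ * _ / _ * _).
  rewrite (big_morph _ (exprD z) (expr0 z)) [RHS]big_mkcond.
  apply: eq_bigr => i _; rewrite exprM.
  (* The index i + 2 = r, absent from the exponent, contributes a power of z^r = 1. *)
  case: ltnP => // im.
  have -> : i.+2 = m.+1 by apply/eqP; rewrite eqn_leq im ltnS ltn_ord.
  by rewrite zr expr1n.
Qed.
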